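(* Let $g$ be a loopless connected planar graph with at least $2$ vertices, with a fixed smooth embedding in $\mathbb{R}^2$, and let $G$ be the graph canonically constructed from $g$ as described in the context. Then \[ M(G)=\sum_{A\in\mathrm{Luc}(g)} 2^{\mathrm{Sp}(A)}, \] where $M(G)$ is the number of perfect matchings of $G$, $\mathrm{Luc}(g)$ is the set of Lucas-colorings of $g$ and $\mathrm{Sp}(A)$ is the number of special vertices of $A$.
   Context: Lucas-coloring: for a planar graph $g=(V,E)$ with a fixed embedding, each set $E_v$ of edges incident to a vertex $v$ carries a cyclic order. A Lucas-coloring of $g$ is a coloring $A:E\to\{y,n\}$ such that for every vertex $v$, the edges of $E_v$ colored $n$ can be partitioned into pairs of edges that are consecutive in the cyclic order of $E_v$. A vertex is special for $A$ if all its incident edges are colored $n$; $\mathrm{Sp}(A)$ is the number of special vertices. Polygon graph $P_m$ ($m\ge 2$): the cycle on $m$ vertices, where $P_2$ means two vertices joined by two parallel edges. Construction of $G$: for each vertex $v_i$ of $g$ with degree $n_i=\deg(v_i)\ge 2$, choose a small closed disk $B_i$ centered at $v_i$ whose boundary circle meets the embedded graph in exactly $n_i$ points, one on each edge incident to $v_i$ (the disks being pairwise disjoint). Replace the part of $g$ inside $B_i$ by the polygon graph $P_{n_i}$ whose vertices are these $n_i$ boundary points, joined consecutively in their cyclic order around the circle. Vertices of degree $1$ are left unchanged. Each edge of $g$ contributes the remaining segment of it outside the disks as an edge of $G$ (joining two boundary points, or a degree-one vertex and a boundary point). *)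

(* Defs.v *)
From HB Require Import structures.
From mathcomp Require Import all_boot all_order all_algebra.
From mathcomp Require Import all_classical all_reals all_analysis.

Set Implicit Arguments.
Unset Strict Implicit.
Unset Printing Implicit Defensive.

Import Order.TTheory GRing.Theory Num.Theory.
Import numFieldNormedType.Exports.

Local Open Scope ring_scope.

(** * Finite multigraphs *)

(* Parallel edges are allowed; the order of the two ends of an edge only serves
   to orient the curve that represents the edge in an embedding. *)
Record multigraph := Multigraph {
  vertex : finType;
  edge : finType;
  src : edge -> vertex;
  tgt : edge -> vertex }.

Section Multigraph.
Variable g : multigraph.
Implicit Types (u v : vertex g) (e : edge g) (M : {set edge g}).

Definition incident v e : bool := (v == src e) || (v == tgt e).

Definition loopless : Prop := forall e, src e <> tgt e.

Definition adjacent u v : bool := [exists e, incident u e && incident v e].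

Definition graph_connected : Prop := forall u v, connect adjacent u v.

(* The degree of v when g is loopless. *)
Definition deg v : nat := #|[set e | incident v e]|.

Definition perfect_matching M : bool :=
  [forall v, #|[set e in M | incident v e]| == 1%N].

Definition num_perfect_matchings : nat := #|[set M | perfect_matching M]|.

End Multigraph.

(** * Plane geometry *)

Section Plane.
Variable R : realType.
Implicit Types (c p q s : R * R) (rho alpha beta : R).

Definition on_circle c rho p : Prop :=
  (p.1 - c.1) ^+ 2 + (p.2 - c.2) ^+ 2 = rho ^+ 2.

Definition in_closed_disk c rho p : Prop :=
  (p.1 - c.1) ^+ 2 + (p.2 - c.2) ^+ 2 <= rho ^+ 2.

Definition rotation c alpha p : R * R :=
  (c.1 + (cos alpha * (p.1 - c.1) - sin alpha * (p.2 - c.2)),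
   c.2 + (sin alpha * (p.1 - c.1) + cos alpha * (p.2 - c.2))).

(* Going once counterclockwise around c, starting from p, one meets q before s. *)
Definition ccw c p q s : Prop :=
  exists alpha beta, [/\ 0 < alpha, alpha < beta, beta < 2 * pi,
    q = rotation c alpha p & s = rotation c beta p].

(* A smooth map on the compact interval [0, 1] is the restriction of a smooth
   map on the real line, so smoothness is required everywhere. *)
Definition smooth_path (gamma : R -> R * R) : Prop :=
  forall (k : nat) (t : R),
    derivable (derive1n k (fun x => (gamma x).1)) t 1 /\
    derivable (derive1n k (fun x => (gamma x).2)) t 1.

Definition velocity (gamma : R -> R * R) (t : R) : R * R :=
  (derive1 (fun x => (gamma x).1) t, derive1 (fun x => (gamma x).2) t).

End Plane.

(** * Smooth embeddings of a graph in the plane *)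

Record smooth_embedding (R : realType) (g : multigraph) := SmoothEmbedding {
  pos : vertex g -> R * R;
  curve : edge g -> R -> R * R;
  pos_inj : injective pos;
  curve_src : forall e, curve e 0 = pos (src e);
  curve_tgt : forall e, curve e 1 = pos (tgt e);
  curve_smooth : forall e, smooth_path (curve e);
  curve_regular : forall e (t : R), 0 <= t <= 1 -> velocity (curve e) t <> (0, 0);
  curve_vertex : forall e v (t : R), 0 < t < 1 -> curve e t <> pos v;
  curve_disjoint : forall e f (s t : R), 0 < s < 1 -> 0 <= t <= 1 ->
    curve e s = curve f t -> e = f /\ s = t }.

Section Embedded.
Variables (R : realType) (g : multigraph) (emb : smooth_embedding R g).
Implicit Types (v w : vertex g) (e f h : edge g) (rho : R) (p q s : R * R).

Definition on_edge e p : Prop := exists2 t : R, 0 <= t <= 1 & curve emb e t = p.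

(* p is a point of e on the circle of radius rho centred at v. *)
Definition boundary_point v rho e p : Prop :=
  on_edge e p /\ on_circle (pos emb v) rho p.

(** ** The cyclic order of the edges around a vertex *)

Definition ccw_at v rho e f h : Prop :=
  exists p q s, [/\ boundary_point v rho e p, boundary_point v rho f q,
    boundary_point v rho h s & ccw (pos emb v) p q s].

(* f comes right after e on the circle of radius rho centred at v: no edge at v
   is met strictly between e and f.  If deg v = 2, each of the two edges comes
   right after the other. *)
Definition next_on_circle v rho e f : Prop :=
  [/\ incident v e, incident v f, e <> f &
      forall h, incident v h -> ~ ccw_at v rho e h f].

(* The cyclic order of the edges at v is their order on all sufficiently small
   circles centred at v; since the edges are regular curves, such a circle meets
   each of them once. *)
Definition next_edge v e f : Prop :=
  (\forall rho \near (0:R)^'+, next_on_circle v rho e f)%classic.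

Definition consecutive v e f : Prop := next_edge v e f \/ next_edge v f e.

(** ** Lucas-colorings: [true] stands for y and [false] for n *)

Implicit Type A : {ffun edge g -> bool}.

Definition n_edges A v : {set edge g} := [set e | incident v e & ~~ A e].

Definition lucas A : Prop :=
  forall v, exists2 P : {set {set edge g}}, finset.partition P (n_edges A v) &
    forall B, B \in P -> exists e f, [/\ B = [set e; f], e <> f & consecutive v e f].

Definition Luc : {set {ffun edge g -> bool}} := [set A | `[< lucas A >]].

Definition special A v : bool := [forall e, incident v e ==> ~~ A e].

Definition Sp A : nat := #|[set v | special A v]|.

(** ** The graph obtained by inserting polygons *)

Definition meets_once v rho e : Prop := exists! p, boundary_point v rho e p.

Definition avoids v rho e : Prop := forall p, ~ boundary_point v rho e p.

(* r v is the radius of the disk around v; it is irrelevant when deg v = 1.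
   That the disk is small means that every concentric circle inside it, and not
   only its boundary, meets each edge at v once and no other edge.  All small
   enough radii are admissible. *)
Record small_disks (r : vertex g -> R) : Prop := SmallDisks {
  disk_gt0 : forall v, (1 < deg v)%N -> 0 < r v;
  disk_incident : forall v rho e, (1 < deg v)%N -> 0 < rho <= r v ->
    incident v e -> meets_once v rho e;
  disk_other : forall v rho e, (1 < deg v)%N -> 0 < rho <= r v ->
    ~~ incident v e -> avoids v rho e;
  disk_vertex : forall v w, (1 < deg v)%N -> v <> w ->
    ~ in_closed_disk (pos emb v) (r v) (pos emb w);
  disk_disjoint : forall v w, (1 < deg v)%N -> (1 < deg w)%N -> v <> w ->
    forall p, ~ (in_closed_disk (pos emb v) (r v) p /\
                 in_closed_disk (pos emb w) (r w) p) }.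

Variable r : vertex g -> R.

(* The pair (v, e) with e incident to v stands for the point of e on the boundary
   of the disk around v if deg v >= 2, and for v itself if deg v = 1 (then e is
   the only edge at v). *)
Definition corner : finType := {x : vertex g * edge g | incident x.1 x.2}.

Lemma incident_src e : incident (src e) e.
Proof. by rewrite /incident eqxx. Qed.

Lemma incident_tgt e : incident (tgt e) e.
Proof. by rewrite /incident eqxx orbT. Qed.

Definition src_corner e : corner := exist _ (src e, e) (incident_src e).
Definition tgt_corner e : corner := exist _ (tgt e, e) (incident_tgt e).

(* The pair (x, y) is the side from x to y of the polygon around their common
   vertex.  For deg v = 2, (x, y) and (y, x) are the two parallel edges of the
   2-gon; for deg v = 1 there is no side. *)
Definition side_pred (xy : corner * corner) : bool :=
  let: (v, e) := val xy.1 in let: (w, f) := val xy.2 in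
  (v == w) && `[< next_on_circle v (r v) e f >].

Definition side : finType := {xy : corner * corner | side_pred xy}.

(* An edge is the part outside the disks of an edge of g, or a polygon side. *)
Definition polygon_graph : multigraph :=
  @Multigraph corner (edge g + side)%type
    (fun a => match a with inl e => src_corner e | inr xy => (val xy).1 end)
    (fun a => match a with inl e => tgt_corner e | inr xy => (val xy).2 end).

End Embedded.

(* Main.v *)
Require Import Defs.
From HB Require Import structures.
From mathcomp Require Import all_boot all_order all_algebra.
From mathcomp Require Import all_classical all_reals all_analysis.
From mathcomp Require Import ring lra.

(** Sending a perfect matching of G to the set of edges of g that it uses
    (coloured y) yields a Lucas-coloring: the corners left over at a vertex are
    matched by polygon sides, i.e. in consecutive pairs.  Conversely, every
    Lucas-coloring arises.  Two matchings over the same coloring agree or are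
    complementary on each polygon, because membership of one side forces that of the
    next one; complementing is possible exactly at the special vertices, hence the
    fibre has [2 ^ Sp A] elements.

    The polygons are read off on circles of radius [r v], the consecutive pairs on
    arbitrarily small circles.  The two cyclic orders coincide: the points where
    three edges meet the circle of radius rho move continuously with rho and stay
    distinct, so the sign of the determinant that orients them is constant. *)

Set Implicit Arguments.
Unset Strict Implicit.
Unset Printing Implicit Defensive.

Import Order.TTheory GRing.Theory Num.Theory.
Import numFieldNormedType.Exports.

(** * Cyclic order on a circle, expressed by the sign of a determinant *)

Section Circle.
Local Open Scope ring_scope.
Variable R : realType.
Implicit Types (c p q s u : R * R) (rho alpha beta : R).

Definition orient p q s : R :=
  (q.1 - p.1) * (s.2 - p.2) - (q.2 - p.2) * (s.1 - p.1).

Lemma orient_swap p q s : orient p s q = - orient p q s.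
Proof. by rewrite /orient; ring. Qed.

(** The angle [acos x] has cosine [x] and sine [|y|]; a negative [y] calls for the reflected angle
    [2 * pi - acos x]. *)
Lemma angle_exists (x y : R) : x ^+ 2 + y ^+ 2 = 1 ->
  exists2 a, 0 <= a < 2 * pi & x = cos a /\ y = sin a.
Proof.
move=> xy1; have x11 : -1 <= x <= 1 by apply/andP; split; nra.
have sE : sin (acos x) = `|y|.
  by rewrite sin_acos// -xy1 [_ + y ^+ 2]addrC addrK sqrtr_sqr.
have cE : cos (acos x) = x by rewrite acosK.
have a0 := acos_ge0 x11; have api := acos_lepi x11; have pi0 := pi_gt0 R.
have [y0|y0] := leP 0 y.
  by exists (acos x); [apply/andP; split=> //; lra|rewrite cE sE ger0_norm].
exists (2 * pi - acos x); last first.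
  have -> : 2 * pi = pi *+ 2 :> R by rewrite mulr_natl.
  rewrite addrC cosD2pi sinD2pi cosN sinN cE sE ltr0_norm//.
  by rewrite opprK.
(* A negative [y] excludes [x = 1], so the reflected angle stays strictly below [2 * pi]. *)
have a1 : 0 < acos x.
  apply: acos_gt0; case/andP: x11 => -> /= x1; rewrite lt_neqAle x1 andbT.
  by apply/eqP => x1'; move: xy1; rewrite x1'; nra.
by apply/andP; split; lra.
Qed.

Lemma rotationD c alpha beta p :
  rotation c alpha (rotation c beta p) = rotation c (alpha + beta) p.
Proof.
by rewrite /rotation cosD sinD /=; congr pair; congr (_ + _);
  rewrite ![_ + (_ - _) - _]addrAC; ring.
Qed.

Lemma rotation0 c p : rotation c 0 p = p.
Proof.
by case: p => x y; rewrite /rotation cos0 sin0 /=; congr pair; ring.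
Qed.

Lemma rotation2pi c p : rotation c (2 * pi) p = p.
Proof.
rewrite -[RHS](rotation0 c) /rotation.
have -> : 2 * pi = 0 + pi *+ 2 :> R by rewrite add0r mulr_natl.
by rewrite cosD2pi sinD2pi.
Qed.

Lemma rotation_exists c rho p q : 0 < rho -> on_circle c rho p ->
  on_circle c rho q -> exists2 a, 0 <= a < 2 * pi & q = rotation c a p.
Proof.
rewrite /on_circle; case: p => p1 p2; case: q => q1 q2; case: c => c1 c2 /=.
move=> rho0 hp hq.
have : rho ^+ 2 != 0 by rewrite expf_neq0// gt_eqF.
move: (rho ^+ 2) hp hq => r2 hp hq r2n0.
(* Normalized scalar product and determinant of the two radius vectors: cosine and sine of the angle
   from [p] to [q]. Lagrange's identity gives [x ^+ 2 + y ^+ 2 = 1]. *)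
set x := ((p1 - c1) * (q1 - c1) + (p2 - c2) * (q2 - c2)) / r2.
set y := ((p1 - c1) * (q2 - c2) - (p2 - c2) * (q1 - c1)) / r2.
have [] := @angle_exists x y.
  have r2E : r2 ^+ 2 = ((p1 - c1) ^+ 2 + (p2 - c2) ^+ 2) *
      ((q1 - c1) ^+ 2 + (q2 - c2) ^+ 2) by rewrite hp hq.
  rewrite /x /y !expr_div_n -mulrDl; apply: (mulIf (expf_neq0 2 r2n0)).
  by rewrite mulfVK ?expf_neq0// mul1r r2E; ring.
move=> a a2 [xE yE]; exists a => //; rewrite /rotation -xE -yE /= /x /y.
congr pair; apply: (mulIf r2n0).
  transitivity (c1 * r2 + (q1 - c1) * r2); first by ring.
  by rewrite -{2}hp; field.
transitivity (c2 * r2 + (q2 - c2) * r2); first by ring.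
by rewrite -{2}hp; field.
Qed.

Lemma rotation_inj c rho p alpha beta : 0 < rho -> on_circle c rho p ->
  0 <= alpha < 2 * pi -> 0 <= beta < 2 * pi ->
  rotation c alpha p = rotation c beta p -> alpha = beta.
Proof.
move=> rho0 hp; wlog le_ab : alpha beta / alpha <= beta.
  move=> H ha hb E; have [le|/ltW le] := leP alpha beta; first exact: H.
  by apply/esym/H.
move=> ha hb [/addrI E1 /addrI E2].
have r2 : 0 < rho ^+ 2 by rewrite exprn_gt0.
move: hp E1 E2 r2; rewrite /on_circle.
set x := p.1 - _; set y := p.2 - _ => <- E1 E2 r2.
have Ec : cos alpha = cos beta.
  apply: (mulIf (lt0r_neq0 r2)).
  transitivity (x * (cos alpha * x - sin alpha * y) +
                y * (sin alpha * x + cos alpha * y)); first by ring.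
  by rewrite E1 E2; ring.
have Es : sin alpha = sin beta.
  apply: (mulIf (lt0r_neq0 r2)).
  transitivity (x * (sin alpha * x + cos alpha * y) -
                y * (cos alpha * x - sin alpha * y)); first by ring.
  by rewrite E1 E2; ring.
(* Equal cosines and sines give [cos (beta - alpha) = 1], so half the difference has sine zero; if
   [alpha < beta], that half would lie strictly between [0] and [pi]. *)
have := cosB beta alpha; rewrite Ec Es -!expr2 cos2Dsin2.
set d := (beta - alpha) / 2; have -> : beta - alpha = d *+ 2.
  by rewrite /d -mulr_natr mulfVK.
rewrite cos_mulr2n => cd.
have sd : sin d = 0 by apply/eqP; rewrite -sqrf_eq0 sin2cos2; apply/eqP; lra.
have [//|ab] := eqVneq alpha beta.
have lt_ab : alpha < beta by rewrite lt_neqAle ab.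
suff : 0 < sin d by rewrite sd ltxx.
by apply: sin_gt0_pi; rewrite /d; lra.
Qed.

Lemma ccw_rot c p q s : ccw c p q s -> ccw c q s p.
Proof.
(* These are the angles of [s] and [p] measured from [q]. *)
case=> a [b [a0 ab b2 -> ->]]; exists (b - a), (2 * pi - a).
by split; rewrite ?rotationD ?subrK ?rotation2pi//; lra.
Qed.

Lemma ccw_trans c rho p q s u : 0 < rho -> on_circle c rho p ->
  ccw c p q s -> ccw c p s u -> ccw c p q u.
Proof.
move=> rho0 hp [a [b [a0 ab b2 -> ->]]] [b' [d [b0 bd d2 E ->]]].
have bb' : b = b' by apply: (rotation_inj rho0 hp) E; lra.
by exists a, d; split=> //; lra.
Qed.

Lemma ccw_total c rho p q s : 0 < rho ->
  on_circle c rho p -> on_circle c rho q -> on_circle c rho s ->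
  p <> q -> p <> s -> q <> s -> ccw c p q s \/ ccw c p s q.
Proof.
move=> rho0 hp hq hs pq ps qs.
have [a ha qE] := rotation_exists rho0 hp hq.
have [b hb sE] := rotation_exists rho0 hp hs.
have a0 : a != 0 by apply/eqP => a0; apply: pq; rewrite qE a0 rotation0.
have b0 : b != 0 by apply/eqP => b0; apply: ps; rewrite sE b0 rotation0.
have [lt_ab|lt_ba|ab] := ltgtP a b.
- by left; exists a, b; split=> //; lra.
- by right; exists b, a; split=> //; lra.
- by case: qs; rewrite qE sE ab.
Qed.

(** In the half angles [x = a / 2] and [y = b / 2] the determinant factors as [4 * rho ^+ 2 * (sin x
    * sin y * sin (y - x))], and all three arguments lie strictly between [0] and [pi]. *)
Lemma ccw_orient c rho p q s : 0 < rho -> on_circle c rho p ->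
  ccw c p q s -> 0 < orient p q s.
Proof.
move=> rho0 hp [a [b [a0 ab b2 -> ->]]].
have hh x : x = (x / 2) *+ 2 :> R by rewrite -mulr_natr mulfVK.
set x := a / 2; set y := b / 2.
have Ex : a = x *+ 2 by exact: hh.
have Ey : b = y *+ 2 by exact: hh.
have sx : 0 < sin x by apply: sin_gt0_pi; rewrite /x; lra.
have sy : 0 < sin y by apply: sin_gt0_pi; rewrite /y; lra.
have sxy : 0 < sin (y - x) by apply: sin_gt0_pi; rewrite /x /y; lra.
suff -> : orient p (rotation c a p) (rotation c b p) =
    4 * rho ^+ 2 * (sin x * sin y * sin (y - x)).
  by rewrite !mulr_gt0// ?exprn_gt0.
move: hp; rewrite /on_circle => <-.
rewrite /orient /rotation Ex Ey !sin_mulr2n !cos_mulr2n sinB !cos2sin2 /=.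
by ring.
Qed.

(** Turns the cyclic order into the sign of a polynomial, to which continuity applies. For the
    converse, coincident points have determinant zero and the opposite cyclic order makes it
    negative. *)
Lemma ccwP c rho p q s : 0 < rho ->
  on_circle c rho p -> on_circle c rho q -> on_circle c rho s ->
  ccw c p q s <-> 0 < orient p q s.
Proof.
move=> rho0 hp hq hs; split; first exact: ccw_orient hp.
have [->|/eqP pq] := eqVneq p q; first by rewrite /orient; lra.
have [->|/eqP ps] := eqVneq p s; first by rewrite /orient; lra.
have [->|/eqP qs] := eqVneq q s; first by rewrite /orient; lra.
have [//|/(ccw_orient rho0 hp)] := ccw_total rho0 hp hq hs pq ps qs.
by rewrite orient_swap; lra.
Qed.

End Circle.

(** * Passage times of a curve through concentric circles *)

Section Radial.
Local Open Scope classical_set_scope.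
Local Open Scope ring_scope.
Variable R : realType.

(** [D] stands for the squared distance from the centre along a curve, [tau rho] for the time at
    which that distance is [rho]. Continuity of [tau] comes from its being increasing and onto an
    interval. *)
Lemma radial_time (D : R -> R) (r : R) :
  0 < r -> continuous D -> D 0 = 0 -> (forall t : R, 0 < t <= 1 -> 0 < D t) ->
  (forall rho : R, 0 < rho <= r -> exists2 t : R, 0 <= t <= 1 & D t = rho ^+ 2) ->
  (forall s t : R, 0 <= s <= 1 -> 0 <= t <= 1 -> 0 < D s <= r ^+ 2 ->
     D s = D t -> s = t) ->
  exists2 tau : R -> R, {within `[0, r], continuous tau} &
    forall rho : R, 0 <= rho <= r -> 0 <= tau rho <= 1 /\ D (tau rho) = rho ^+ 2.
Proof.
move=> r0 cD D0 Dpos Dex Dinj.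
have Dge0 (t : R) : 0 <= t <= 1 -> 0 <= D t.
  case/andP; rewrite le_eqVlt => /orP[/eqP <- _|t0 t1]; first by rewrite D0.
  by apply/ltW/Dpos/andP.
(* Injectivity extends to the value [0], which [D] takes only at time [0]. *)
have {}Dinj (s t : R) : 0 <= s <= 1 -> 0 <= t <= 1 -> D s <= r ^+ 2 ->
    D s = D t -> s = t.
  move=> hs ht Ds DE; have [|] := boolP (0 < D s).
    by move=> Dp; apply: Dinj => //; rewrite Dp.
  rewrite -leNgt => Dle.
  have eq0 (u : R) : 0 <= u <= 1 -> D u <= 0 -> u = 0.
    case/andP; rewrite le_eqVlt => /orP[/eqP <- //|u0 u1].
    by rewrite leNgt Dpos// u0.
  by rewrite (eq0 s hs Dle) (eq0 t ht)// -DE.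
have /choice[tau tauP] : forall rho : R, exists t : R,
    0 <= rho <= r -> 0 <= t <= 1 /\ D t = rho ^+ 2.
  move=> rho; have [/andP[]|] := boolP (0 <= rho <= r); last by exists 0.
  rewrite le_eqVlt => /orP[/eqP <- _|rho0 rhor].
    by exists 0 => _; rewrite D0 expr0n lexx ler01.
  by have [|t t01 Dt] := Dex rho; [rewrite rho0|exists t].
exists tau => //.
(* Since [D] starts at [0], every value up to [D t] is attained no later than [t]. *)
have ivt (t v : R) : 0 <= t <= 1 -> 0 <= v <= D t ->
    exists2 c : R, 0 <= c <= t & D c = v.
  move=> /[dup] ht /andP[t0 t1] hv.
  have [||c] := @IVT R D 0 t v t0; first exact: continuous_subspaceT.
    by rewrite D0 min_l ?max_r ?Dge0.
  by rewrite in_itv; exists c.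
have sq (x y : R) : 0 <= x -> x <= y -> x ^+ 2 <= y ^+ 2 by move=> *; nra.
apply: segment_inc_surj_continuous.
  (* The value [x ^+ 2] is attained by time [tau y], and only at [tau x]; hence [tau x <= tau y],
     and equality would give [x = y]. *)
  apply: le_mono_in => x y; rewrite !in_itv /= => hx hy xy.
  have [tx Dx] := tauP x hx; have [ty Dy] := tauP y hy.
  have [|c /andP[c0 cy] Dc] := ivt (tau y) (x ^+ 2) ty.
    by rewrite sqr_ge0 Dy sq//; lra.
  have cE : c = tau x by apply: Dinj; rewrite ?Dx ?Dc ?sq//; lra.
  rewrite lt_neqAle -cE cy andbT; apply/eqP => E.
  by move: Dc; rewrite E Dy; nra.
have h0 : 0 <= (0 : R) <= r by rewrite lexx ltW.
have hr : 0 <= r <= r by rewrite lexx ltW.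
have [t0 Dt0] := tauP 0 h0; have [tr Dtr] := tauP r hr.
move=> t; rewrite /= in_itv /= => /andP[t0t ttr].
have ht : 0 <= t <= 1 by lra.
(* Otherwise [r ^+ 2] would be attained by time [t], necessarily at [tau r]; with [t <= tau r] this
   forces [t = tau r], a contradiction. *)
have Dtr2 : D t <= r ^+ 2.
  rewrite leNgt; apply/negP => lt_rD.
  have [|c hc Dc] := ivt t (r ^+ 2) ht; first by rewrite sqr_ge0 ltW.
  have cE : c = tau r by apply: Dinj; rewrite ?Dc ?Dtr//; lra.
  have tE : t = c by lra.
  by move: lt_rD; rewrite tE Dc ltxx.
have hs : 0 <= Num.sqrt (D t) <= r.
  rewrite sqrtr_ge0 /= -(ger0_norm (ltW r0)) -sqrtr_sqr.
  by rewrite ler_sqrt// sqr_ge0.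
exists (Num.sqrt (D t)); first by rewrite /= in_itv.
have [ts Ds] := tauP _ hs; rewrite sqr_sqrtr ?Dge0// in Ds.
by apply: Dinj; rewrite ?Ds.
Qed.

End Radial.

(** * Continuous motion of the boundary points with the radius *)

Section RadialParametrization.
Local Open Scope ring_scope.
Variables (R : realType) (g : multigraph) (emb : smooth_embedding R g).
Variable r : vertex g -> R.
Hypotheses (g_loopless : loopless g) (r_small : small_disks emb r).
Implicit Types (v w : vertex g) (e f h : edge g) (rho : R) (p q s : R * R).

(** Interior times are separated by [curve_disjoint]; the two end times could share a point only on
    a loop. *)
Lemma curve_inj e (s t : R) : 0 <= s <= 1 -> 0 <= t <= 1 ->
  curve emb e s = curve emb e t -> s = t.
Proof.
move=> hs ht E.
have [h|h] := boolP (0 < s < 1); first by have [] := curve_disjoint h ht E.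
have [k|k] := boolP (0 < t < 1).
  by have [] := curve_disjoint k hs (esym E).
have end01 (u : R) : 0 <= u <= 1 -> ~~ (0 < u < 1) -> u = 0 \/ u = 1 by lra.
by have [s0|s0] := end01 s hs h; have [t0|t0] := end01 t ht k;
  move: E; rewrite s0 t0 ?curve_src ?curve_tgt => // /pos_inj;
  [|move/esym]; move/g_loopless.
Qed.

Lemma curve_continuous e :
  continuous (fun t => (curve emb e t).1) /\
  continuous (fun t => (curve emb e t).2).
Proof.
by split=> t; have [d1 d2] := @curve_smooth _ _ emb e 0 t;
  apply/differentiable_continuous; rewrite -derivable1_diffP.
Qed.

Lemma boundary_point_vertex v w rho : (1 < deg v)%N -> 0 < rho <= r v ->
  ~ on_circle (pos emb v) rho (pos emb w).
Proof.
move=> dv hrho; rewrite /on_circle; have [->|/eqP vw] := eqVneq v w.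
  by rewrite !subrr; nra.
have := disk_vertex r_small dv vw; rewrite /in_closed_disk => h E.
by apply: h; rewrite E; nra.
Qed.

(** A boundary point is not a vertex, so it is interior to its edge, where [curve_disjoint]
    separates edges. *)
Lemma boundary_point_edge v rho e f p : (1 < deg v)%N -> 0 < rho <= r v ->
  boundary_point emb v rho e p -> boundary_point emb v rho f p -> e = f.
Proof.
move=> dv hrho [[s hs sE] pc] [[t ht tE] _]; have E := etrans sE (esym tE).
have [h|h] := boolP (0 < s < 1); first by have [] := curve_disjoint h ht E.
have [s0|s1] : s = 0 \/ s = 1 by lra.
  by move: pc; rewrite -sE s0 curve_src => /boundary_point_vertex; case.
by move: pc; rewrite -sE s1 curve_tgt => /boundary_point_vertex; case.
Qed.

Lemma boundary_point_uniq v rho e p q : (1 < deg v)%N -> 0 < rho <= r v ->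
  incident v e -> boundary_point emb v rho e p ->
  boundary_point emb v rho e q -> p = q.
Proof.
move=> dv hrho ve hp hq; have [z [_ zP]] := disk_incident r_small dv hrho ve.
by rewrite -(zP p hp) (zP q hq).
Qed.

(** Reversing the parameter when [v] is the target makes the curve always start at [v], as
    [radial_time] requires. *)
Lemma oriented_curve v e : incident v e ->
  exists gam : R -> R * R, [/\ gam 0 = pos emb v,
    continuous (fun t => (gam t).1), continuous (fun t => (gam t).2),
    (forall p, on_edge emb e p <-> exists2 t : R, 0 <= t <= 1 & gam t = p) &
    forall s t : R, 0 <= s <= 1 -> 0 <= t <= 1 -> gam s = gam t -> s = t].
Proof.
have [c1 c2] := curve_continuous e.
case/orP => /eqP->; first (exists (curve emb e); split=> //).
- exact: curve_src.
- exact: curve_inj.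
have cB : continuous (fun t : R => 1 - t).
  by move=> x; apply: cvgB; [exact: cvg_cst|exact: cvg_id].
exists (fun t => curve emb e (1 - t)); split.
- by rewrite subr0 curve_tgt.
- by move=> x; apply: continuous_comp (cB x) (c1 _).
- by move=> x; apply: continuous_comp (cB x) (c2 _).
- move=> p; split=> -[t ht tE]; exists (1 - t); rewrite ?subKr//; lra.
- move=> s t hs ht /curve_inj E; suff : 1 - s = 1 - t by lra.
  by apply: E; lra.
Qed.

(** Follow the oriented curve up to its passage time at radius [rho]. Meeting every concentric
    circle exactly once supplies both the existence and the injectivity assumed in [radial_time]. *)
Lemma radial_param v e : (1 < deg v)%N -> incident v e ->
  exists P : R -> R * R, [/\
    {within `[0, r v], continuous (fun rho => (P rho).1)}%classic,
    {within `[0, r v], continuous (fun rho => (P rho).2)}%classic &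
    forall rho, 0 < rho <= r v -> boundary_point emb v rho e (P rho)].
Proof.
move=> dv ve; have [gam [g0 c1 c2 gE ginj]] := oriented_curve ve.
set c := pos emb v in g0.
pose D (t : R) := ((gam t).1 - c.1) ^+ 2 + ((gam t).2 - c.2) ^+ 2.
have r0 := disk_gt0 r_small dv.
have bpD rho (t : R) : 0 <= t <= 1 -> D t = rho ^+ 2 ->
    boundary_point emb v rho e (gam t).
  by move=> ht Dt; split=> //; apply/gE; exists t.
have [|||||tau ctau tauP] := @radial_time R D (r v) r0.
- move=> x; apply: cvgD; rewrite !expr2; under eq_fun do rewrite expr2;
    by apply: cvgM; apply: cvgB; (exact: cvg_cst || exact: c1 || exact: c2).
- by rewrite /D g0 !subrr expr0n addr0.
- move=> t ht; rewrite /D lt_neqAle addr_ge0 ?sqr_ge0// andbT eq_sym.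
  rewrite paddr_eq0 ?sqr_ge0// !sqrf_eq0 !subr_eq0.
  apply/negP => /andP[/eqP E1 /eqP E2].
  have : t = 0; last by lra.
  apply: ginj; rewrite ?lexx ?ler01//; first by lra.
  by rewrite g0 [LHS]surjective_pairing E1 E2 -surjective_pairing.
- move=> rho hrho.
  have [p [[/gE[t ht tE] pc] _]] := disk_incident r_small dv hrho ve.
  by exists t => //; rewrite -pc -tE.
- move=> s t hs ht /andP[Ds0 Dsr] E.
  (* The circle through [gam s] has radius [Num.sqrt (D s)]; it also contains [gam t], and the edge
     meets it only once. *)
  have sqE : D s = Num.sqrt (D s) ^+ 2 by rewrite sqr_sqrtr// ltW.
  apply: ginj => //; apply: (@boundary_point_uniq v (Num.sqrt (D s)) e) => //.
  + rewrite sqrtr_gt0 Ds0 /= -(ger0_norm (ltW r0)) -sqrtr_sqr.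
    by rewrite ler_sqrt// sqr_ge0.
  + exact: bpD.
  + by apply: bpD => //; rewrite -E.
exists (gam \o tau); split.
- by apply: (@within_continuous_comp _ _ _ _ tau (fun t => (gam t).1)) => // x _;
    exact: c1.
- by apply: (@within_continuous_comp _ _ _ _ tau (fun t => (gam t).2)) => // x _;
    exact: c2.
- move=> rho hrho; have [|ht Dt] := tauP rho; first lra.
  exact: bpD.
Qed.

End RadialParametrization.

(** * Independence of the cyclic order from the radius *)

Section EdgeOrder.
Local Open Scope ring_scope.
Variables (R : realType) (g : multigraph) (emb : smooth_embedding R g).
Variable r : vertex g -> R.
Hypotheses (g_loopless : loopless g) (r_small : small_disks emb r).
Implicit Types (v w : vertex g) (e f h : edge g) (rho : R) (p q s : R * R).

(** Each edge at [v] has a single point on the circle, so the existential in [ccw_at] can be tested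
    on any given boundary points. *)
Lemma ccw_atP v rho e f h p q s : (1 < deg v)%N -> 0 < rho <= r v ->
  incident v e -> incident v f -> incident v h ->
  boundary_point emb v rho e p -> boundary_point emb v rho f q ->
  boundary_point emb v rho h s ->
  ccw_at emb v rho e f h <-> 0 < orient p q s.
Proof.
move=> dv hrho ve vf vh hp hq hs; have rho0 : 0 < rho by case/andP: hrho.
rewrite -(ccwP rho0 hp.2 hq.2 hs.2); split; last by exists p, q, s.
case=> [p' [q' [s' [hp' hq' hs' +]]]].
rewrite (boundary_point_uniq r_small dv hrho ve hp' hp).
rewrite (boundary_point_uniq r_small dv hrho vf hq' hq).
by rewrite (boundary_point_uniq r_small dv hrho vh hs' hs).
Qed.

(* The orientation of the three points at distance rho from v depends continuously
   on rho and does not vanish, so it keeps its sign. *)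
Lemma ccw_at_radius v rho rho' e f h : (1 < deg v)%N ->
  0 < rho <= r v -> 0 < rho' <= r v ->
  incident v e -> incident v f -> incident v h ->
  ccw_at emb v rho e f h -> ccw_at emb v rho' e f h.
Proof.
move=> dv hrho hrho' ve vf vh.
have [P [cP1 cP2 bP]] := radial_param g_loopless r_small dv ve.
have [Q [cQ1 cQ2 bQ]] := radial_param g_loopless r_small dv vf.
have [S [cS1 cS2 bS]] := radial_param g_loopless r_small dv vh.
pose F x := orient (P x) (Q x) (S x).
have FE x : 0 < x <= r v -> ccw_at emb v x e f h <-> 0 < F x.
  by move=> hx; apply: ccw_atP => //; [exact: bP|exact: bQ|exact: bS].
move=> /(FE _ hrho) F1; apply/(FE _ hrho').
have uniq := boundary_point_uniq r_small dv hrho.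
have ef : e <> f.
  move=> E; move: F1; rewrite /F (uniq e _ (Q rho) ve (bP _ hrho)) ?E;
    last exact: bQ.
  by rewrite /orient; lra.
have eh : e <> h.
  move=> E; move: F1; rewrite /F (uniq e _ (S rho) ve (bP _ hrho)) ?E;
    last exact: bS.
  by rewrite /orient; lra.
have fh : f <> h.
  move=> E; move: F1; rewrite /F (uniq f _ (S rho) vf (bQ _ hrho)) ?E;
    last exact: bS.
  by rewrite /orient; lra.
(* Distinct edges give three distinct points; these are in one of the two cyclic orders, and either
   order gives the determinant a strict sign. *)
have F0 x : 0 < x <= r v -> F x <> 0.
  move=> hx; have x0 : 0 < x by case/andP: hx.
  have neq k l p q : k <> l -> boundary_point emb v x k p ->
      boundary_point emb v x l q -> p <> q.
    move=> kl hp hq E; apply: kl.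
    by apply: (boundary_point_edge r_small dv hx hp); rewrite E.
  have [|||||||] := @ccw_total _ (pos emb v) x (P x) (Q x) (S x) x0.
  - exact: (bP _ hx).2.
  - exact: (bQ _ hx).2.
  - exact: (bS _ hx).2.
  - exact: neq ef (bP _ hx) (bQ _ hx).
  - exact: neq eh (bP _ hx) (bS _ hx).
  - exact: neq fh (bQ _ hx) (bS _ hx).
  - by move/(ccw_orient x0 (bP _ hx).2); rewrite /F; lra.
  - by move/(ccw_orient x0 (bP _ hx).2); rewrite orient_swap /F; lra.
have cF : {within `[0, r v], continuous F}%classic.
  move=> x; apply: cvgB; apply: cvgM; apply: cvgB;
    (exact: cP1 || exact: cP2 || exact: cQ1 || exact: cQ2 ||
     exact: cS1 || exact: cS2).
rewrite ltNge; apply/negP => F2.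
(* A change of sign would produce a zero of [F] at an intermediate radius. *)
have ivt a b : 0 < a <= r v -> 0 < b <= r v -> a <= b ->
    Num.min (F a) (F b) <= 0 <= Num.max (F a) (F b) -> False.
  move=> ha hb ab h0; have [|c] := IVT ab _ h0.
    apply: continuous_subspaceW cF => x; rewrite /= !in_itv /=; lra.
  by rewrite in_itv /= => hc; apply: F0; lra.
have [le|/ltW le] := leP rho rho'.
  by apply: (ivt _ _ hrho hrho' le); rewrite ge_min le_max F2 (ltW F1) orbT.
by apply: (ivt _ _ hrho' hrho le); rewrite ge_min le_max F2 (ltW F1) orbT.
Qed.

Lemma next_on_circle_radius v rho rho' e f : (1 < deg v)%N ->
  0 < rho <= r v -> 0 < rho' <= r v ->
  next_on_circle emb v rho e f -> next_on_circle emb v rho' e f.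
Proof.
move=> dv hrho hrho' [ve vf ef N]; split=> // h vh hN; apply: (N h vh).
exact: ccw_at_radius hN.
Qed.

Lemma deg_gt1 v e f : incident v e -> incident v f -> e <> f -> (1 < deg v)%N.
Proof.
move=> ve vf /eqP ef; have : ([set e; f] \subset [set h | incident v h])%SET.
  by apply/fintype.subsetP => h; rewrite !inE => /orP[]/eqP->.
by move/subset_leq_card; rewrite cards2 ef.
Qed.

(** One small radius below [r v] suffices from left to right, and all such radii inherit the
    relation from right to left. If the degree is below 2, both sides fail for lack of two distinct
    edges. *)
Lemma next_edgeP v e f :
  next_edge emb v e f <-> next_on_circle emb v (r v) e f.
Proof.
have [dv|dv] := ltnP 1 (deg v); last first.
  split=> [N|[]].
    have [rho [ve vf ef _]] := @filter_ex _ (at_right 0) _ _ N.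
    by have := deg_gt1 ve vf ef; rewrite ltnNge dv.
  by move=> ve vf ef; have := deg_gt1 ve vf ef; rewrite ltnNge dv.
have r0 := disk_gt0 r_small dv; have hr : 0 < r v <= r v by rewrite r0 /=.
split=> [N|N].
  have [rho [[Nrho rho0] rhor]] :=
    @filter_ex _ (at_right 0) _ _
      (filterI (filterI N (nbhs_right_gt 0)) (nbhs_right_lt r0)).
  by apply: next_on_circle_radius dv _ hr Nrho; rewrite rho0 ltW.
near=> rho; apply: next_on_circle_radius dv hr _ N; apply/andP; split=> //.
near: rho; exact: nbhs_right_le.
Unshelve. all: by end_near. Qed.

(** * The successor relation as a single cycle on the edges at a vertex *)

Section CyclicOrder.
Variable v : vertex g.
Hypothesis dv : (1 < deg v)%N.

Let hr : 0 < r v <= r v.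
Proof. by rewrite lexx (disk_gt0 r_small dv). Qed.

Let between e f h := ccw_at emb v (r v) e f h.

Let point e : incident v e -> exists p, boundary_point emb v (r v) e p.
Proof. by move=> /(disk_incident r_small dv hr)[p [hp _]]; exists p. Qed.

Let between_rot e f h : between e f h -> between f h e.
Proof.
by move=> [p [q [s [hp hq hs /ccw_rot c]]]]; exists q, s, p.
Qed.

Let between_neq e f h : incident v e -> incident v f -> incident v h ->
  between e f h -> [/\ e <> f, e <> h & f <> h].
Proof.
move=> ve vf vh B; have [p hp] := point ve; have [q hq] := point vf.
have [s hs] := point vh.
have /(ccw_atP dv hr ve vf vh hp hq hs) := B.
have uniq := boundary_point_uniq r_small dv hr.
move=> o; split=> E; subst; move: o.
- by rewrite (uniq _ p q vf hp hq) /orient; lra.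
- by rewrite (uniq _ p s vh hp hs) /orient; lra.
- by rewrite (uniq _ q s vh hq hs) /orient; lra.
Qed.

Let between_total e f h : incident v e -> incident v f -> incident v h ->
  e <> f -> e <> h -> f <> h -> between e f h \/ between e h f.
Proof.
move=> ve vf vh ef eh fh; have [p hp] := point ve; have [q hq] := point vf.
have [s hs] := point vh; have [r0 _] := andP hr.
have neq k l p' q' : k <> l -> boundary_point emb v (r v) k p' ->
    boundary_point emb v (r v) l q' -> p' <> q'.
  move=> kl hp' hq' E; apply: kl.
  by apply: (boundary_point_edge r_small dv hr hp'); rewrite E.
have [c|c] := ccw_total r0 hp.2 hq.2 hs.2 (neq _ _ _ _ ef hp hq)
  (neq _ _ _ _ eh hp hs) (neq _ _ _ _ fh hq hs).
  by left; exists p, q, s.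
by right; exists p, s, q.
Qed.

Let between_trans e f h k : incident v e -> incident v h ->
  between e f h -> between e h k -> between e f k.
Proof.
move=> ve vh [p [q [s [hp hq hs c]]]] [p' [s' [u [hp' hs' hu]]]].
have uniq := boundary_point_uniq r_small dv hr.
rewrite (uniq _ p' p ve hp' hp) (uniq _ s' s vh hs' hs) => c'.
exists p, q, u; split=> //; have [r0 _] := andP hr.
exact: ccw_trans r0 hp.2 c c'.
Qed.

Let next e f := next_on_circle emb v (r v) e f.

(** Of two distinct successors, one would lie between [e] and the other. *)
Lemma next_on_circle_funct e f f' : next e f -> next e f' -> f = f'.
Proof.
move=> [ve vf ef N] [_ vf' ef' N']; have [//|/eqP ff'] := eqVneq f f'.
by have [/(N' f vf)|/(N f' vf')] := between_total ve vf vf' ef ef' ff'.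
Qed.

Lemma next_on_circle_inj e e' f : next e f -> next e' f -> e = e'.
Proof.
move=> [ve vf ef N] [ve' _ e'f N']; have [//|/eqP ee'] := eqVneq e e'.
have [] := between_total vf ve ve' (nesym ef) (nesym e'f) ee'.
  by move/between_rot/(N e' ve').
by move/between_rot/(N' e ve).
Qed.

(** Take [f] with the fewest edges strictly between [e] and [f]: an edge in between would have fewer
    still, by transitivity. *)
Lemma next_on_circle_exists e : incident v e -> exists f, next e f.
Proof.
move=> ve; pose inside f := [set k | incident v k & `[< between e k f >]].
have [f0 vf0 ef0] : exists2 f, incident v f & f != e.
  move: dv; rewrite /deg (cardsD1 e) inE ve ltnS => /card_gt0P[f].
  by rewrite !inE => /andP[? ?]; exists f.
have P0 : incident v f0 && (f0 != e) by rewrite vf0.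
have [f /andP[vf fe] fmin] := @arg_minnP _ f0 (fun f => incident v f && (f != e))
  (fun f => #|inside f|) P0.
exists f; split=> // [|h vh B]; first by apply/nesym/eqP.
have [eh ef hf] := between_neq ve vh vf B.
have := fmin h; rewrite vh (introN eqP (nesym eh)) => /(_ isT).
rewrite leqNgt => /negP; apply; apply: proper_card; apply/properP; split.
  apply/fintype.subsetP => k; rewrite !inE => /andP[-> /asboolP B'].
  by apply/asboolP; exact: between_trans B' B.
exists h; rewrite !inE vh /=; first exact/asboolP.
by apply/asboolP => /(between_neq ve vh vh)[].
Qed.

(** Iterating the successor from [e] reaches every edge at [v]. The induction is on the number of
    edges strictly between [e] and [f], which drops at each step. *)
Lemma next_on_circle_closed (X : pred (edge g)) e f :
  (forall k l, next k l -> X k -> X l) ->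
  incident v e -> incident v f -> X e -> X f.
Proof.
move=> Xn; pose inside e f := [set k | incident v k & `[< between e k f >]].
have [n] := ubnP #|inside e f|; elim: n e => // n IHn e lt_n ve vf Xe.
have [<-//|/eqP ef] := eqVneq e f.
have [e' Ne'] := next_on_circle_exists ve.
have Xe' := Xn _ _ Ne' Xe; have [_ ve' ee' N] := Ne'.
have [<-//|/eqP e'f] := eqVneq e' f.
have B : between e e' f.
  by have [//|/(N f vf)] := between_total ve ve' vf ee' ef e'f.
apply: (IHn e') => //; rewrite -ltnS; apply: leq_trans lt_n; rewrite ltnS.
apply: proper_card; apply/properP; split.
  apply/fintype.subsetP => k; rewrite !inE => /andP[vk /asboolP B']; rewrite vk /=.
  (* Transitivity holds for triples with a common first edge, so the triples are rotated to start at
     [f]. *)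
  apply/asboolP; apply: between_rot; apply: between_trans vf ve' _ _.
    exact/between_rot/between_rot/B.
  exact/between_rot/between_rot/B'.
exists e'; rewrite !inE ve' /=; first exact/asboolP.
by apply/asboolP => /(between_neq ve' ve' vf)[].
Qed.

(** Without a predecessor of [f], being different from [f] would be preserved by successors, yet
    iterating from the successor of [f] comes back to [f]. *)
Lemma prev_on_circle_exists f : incident v f -> exists e, next e f.
Proof.
move=> vf; apply: contrapT => noprev; have [f' N] := next_on_circle_exists vf.
have [_ vf' ff' _] := N.
have := @next_on_circle_closed (predC1 f) f' f _ vf' vf.
rewrite /= eqxx => H; suff : false by [].
apply: H; last by apply/eqP/nesym.
by move=> k l Nkl _; apply/eqP => lf; apply: noprev; exists k; rewrite -lf.
Qed.

End CyclicOrder.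

End EdgeOrder.

(** * Corners and sides of the polygons *)

Section Counting.
Variables (R : realType) (g : multigraph) (emb : smooth_embedding R g).
Variable r : vertex g -> R.
Hypotheses (g_loopless : loopless g) (r_small : small_disks emb r).
Implicit Types (v w : vertex g) (e f h : edge g) (c d : corner g).

Local Notation G := (polygon_graph emb r).
Implicit Types (s t : side emb r) (M : {set edge G}).

Definition corner_vertex c : vertex g := (val c).1.
Definition corner_edge c : edge g := (val c).2.
Definition side_vertex s : vertex g := corner_vertex (val s).1.

Local Notation next c d := (next_on_circle emb (corner_vertex c)
  (r (corner_vertex c)) (corner_edge c) (corner_edge d)).

Lemma corner_eq c d : corner_vertex c = corner_vertex d ->
  corner_edge c = corner_edge d -> c = d.
Proof.
case: c d => [[v e] ve] [[w f] wf]; rewrite /corner_vertex /corner_edge /=.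
by move=> vw ef; apply: val_inj; rewrite /= vw ef.
Qed.

Lemma corner_exists v e : incident v e ->
  exists2 c, corner_vertex c = v & corner_edge c = e.
Proof. by move=> ve; exists (exist _ (v, e) ve). Qed.

Lemma side_predP c d : reflect (corner_vertex c = corner_vertex d /\ next c d)
  (@side_pred R g emb r (c, d)).
Proof.
case: c d => [[v e] ve] [[w f] wf]; rewrite /side_pred /corner_vertex /=.
by apply: (iffP andP) => -[] /eqP vw /asboolP N; split=> //; exact/eqP.
Qed.

Lemma sideP s : corner_vertex (val s).1 = corner_vertex (val s).2 /\
  next (val s).1 (val s).2.
Proof. by apply/side_predP; rewrite -surjective_pairing; exact: (valP s). Qed.

Lemma side_eq s t : (val s).1 = (val t).1 -> (val s).2 = (val t).2 -> s = t.
Proof.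
by move=> E1 E2; apply: val_inj; rewrite [LHS]surjective_pairing E1 E2
  -surjective_pairing.
Qed.

Lemma side_deg s : 1 < deg (side_vertex s).
Proof. by have [_ [vc vd cd _]] := sideP s; exact: deg_gt1 vc vd cd. Qed.

Lemma side_src_inj s t : (val s).1 = (val t).1 -> s = t.
Proof.
move=> E; apply: side_eq => //; have [vs Ns] := sideP s; have [vt Nt] := sideP t.
apply: corner_eq; first by rewrite -vs -vt E.
rewrite -E in Nt.
exact: (next_on_circle_funct r_small (side_deg s) Ns Nt).
Qed.

Lemma side_tgt_inj s t : (val s).2 = (val t).2 -> s = t.
Proof.
move=> E; apply: side_eq => //; have [vs Ns] := sideP s; have [vt Nt] := sideP t.
have Ev : corner_vertex (val s).1 = corner_vertex (val t).1 by rewrite vs vt E.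
apply: corner_eq => //; rewrite -E -Ev in Nt.
exact: (next_on_circle_inj r_small (side_deg s) Ns Nt).
Qed.

Lemma side_neq s : (val s).1 <> (val s).2.
Proof. by move=> E; have [_ [_ _ + _]] := sideP s; rewrite E; apply. Qed.

Lemma side_of_next v e f : next_on_circle emb v (r v) e f ->
  exists s, [/\ side_vertex s = v, corner_edge (val s).1 = e &
                corner_edge (val s).2 = f].
Proof.
move=> N; have [ve vf _ _] := N.
have [c cv ce] := corner_exists ve; have [d dv df] := corner_exists vf.
have cd : @side_pred R g emb r (c, d).
  by apply/side_predP; rewrite cv dv ce df.
by exists (exist _ (c, d) cd).
Qed.

Lemma corner_incident c : incident (corner_vertex c) (corner_edge c).
Proof. exact: valP c. Qed.

Lemma side_src_exists c : 1 < deg (corner_vertex c) -> exists s, (val s).1 = c.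
Proof.
move=> dc; have [f] := next_on_circle_exists r_small dc (corner_incident c).
by move=> /side_of_next[s [sv sc _]]; exists s; exact: corner_eq.
Qed.

Lemma side_tgt_exists c : 1 < deg (corner_vertex c) -> exists s, (val s).2 = c.
Proof.
move=> dc; have [f] := prev_on_circle_exists r_small dc (corner_incident c).
move=> /side_of_next[s [sv _ sc]]; exists s; apply: corner_eq => //.
by rewrite -sv -(sideP s).1.
Qed.

(** Carries the single-cycle principle over from edges at a vertex to the sides of its polygon. *)
Lemma side_closed (X : pred (side emb r)) :
  (forall s t, (val s).2 = (val t).1 -> X s -> X t) ->
  forall s t, side_vertex s = side_vertex t -> X s -> X t.
Proof.
move=> Xn s t st Xs; have dv := side_deg s.
(* A side is determined by the corner it starts from, so [X] can be read as a predicate on the edges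
   at the vertex. *)
pose Y e := [exists u, [&& X u, side_vertex u == side_vertex s &
  corner_edge (val u).1 == e]].
have YE u : side_vertex u = side_vertex s -> Y (corner_edge (val u).1) -> X u.
  move=> us /existsP[u' /and3P[Xu' /eqP u's /eqP u'u]].
  suff -> : u = u' by [].
  by apply: side_src_inj; apply: corner_eq => //; rewrite -/(side_vertex _) us -u's.
apply: YE => //.
apply: (@next_on_circle_closed _ _ _ _ r_small _ dv Y (corner_edge (val s).1)).
- move=> k l Nkl /existsP[u /and3P[Xu /eqP us /eqP uk]].
  have [_ vl _ _] := Nkl; have [c cv cl] := corner_exists vl.
  have [|u' u'c] := @side_src_exists c; first by rewrite cv.
  apply/existsP; exists u'; rewrite /side_vertex u'c cv cl !eqxx !andbT.
  apply: Xn Xu; rewrite u'c; have [vu Nu] := sideP u.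
  apply: corner_eq; first by rewrite -vu cv.
  rewrite cl; move: Nu; rewrite uk -[corner_vertex (val u).1]/(side_vertex u) us.
  by move=> Nu; exact: (next_on_circle_funct r_small dv Nu Nkl).
- exact: corner_incident.
- by rewrite st; exact: corner_incident.
- by apply/existsP; exists s; rewrite Xs !eqxx.
Qed.

(** * Incidence and perfect matchings in the polygon graph *)

Lemma incident_inl c e : @incident G c (inl e) = (e == corner_edge c).
Proof.
apply/orP/eqP => [[]/eqP->//|->].
by case/orP: (corner_incident c) => /eqP E; [left|right]; apply/eqP;
  exact: corner_eq.
Qed.

Lemma incident_inr c s :
  @incident G c (inr s) = (c == (val s).1) || (c == (val s).2).
Proof. by []. Qed.

Lemma side_vertex_incident c s : @incident G c (inr s) ->
  side_vertex s = corner_vertex c.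
Proof. by case/orP => /eqP->//; rewrite /side_vertex (sideP s).1. Qed.

Lemma matched_once M c (a b : edge G) : perfect_matching M ->
  a \in M -> b \in M -> @incident G c a -> @incident G c b -> a = b.
Proof.
move=> /forallP/(_ c)/cards1P[x xE] aM bM ca cb.
have : a \in [set e in M | @incident G c e] by rewrite inE aM.
have : b \in [set e in M | @incident G c e] by rewrite inE bM.
by rewrite xE !inE => /eqP-> /eqP->.
Qed.

Lemma matched M c : perfect_matching M ->
  exists2 a : edge G, a \in M & @incident G c a.
Proof.
move=> /forallP/(_ c)/cards1P[x xE].
by have := set11 x; rewrite -xE inE => /andP[]; exists x.
Qed.

Lemma perfect_matchingI M :
  (forall c, exists2 a : edge G, (a \in M) && @incident G c a &
    forall b : edge G, b \in M -> @incident G c b -> b = a) ->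
  perfect_matching M.
Proof.
move=> H; apply/forallP => c; have [a aP aU] := H c.
apply/cards1P; exists a; apply/setP => b; rewrite !inE.
by apply/andP/eqP => [[bM cb]|->]; [exact: aU|exact/andP].
Qed.

(** * From matchings to Lucas-colorings and back *)

Definition trace M : {ffun edge g -> bool} := [ffun e => inl e \in M].

(** Unordered, because the blocks of a Lucas partition are; the two sides of a 2-gon therefore get
    the same set. *)
Definition side_edges s : {set edge g} :=
  [set corner_edge (val s).1; corner_edge (val s).2].

Lemma incident_side_edges s c : side_vertex s = corner_vertex c ->
  (corner_edge c \in side_edges s) = @incident G c (inr s).
Proof.
move=> sc; rewrite !inE incident_inr; congr orb; apply/eqP/eqP => [E|->//].
  by apply: corner_eq.
by apply: corner_eq; rewrite // -sc -(sideP s).1.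
Qed.

Lemma side_edges_incident s e : e \in side_edges s -> incident (side_vertex s) e.
Proof.
rewrite !inE => /orP[]/eqP->; first exact: corner_incident.
by rewrite /side_vertex (sideP s).1; exact: corner_incident.
Qed.

Lemma trace_lucas M : perfect_matching M -> trace M \in Luc emb.
Proof.
move=> pM; rewrite inE; apply/asboolP => v.
pose S := [set s | (inr s \in M) && (side_vertex s == v)].
have blockE s e : s \in S -> e \in side_edges s ->
    exists2 c, corner_vertex c = v /\ corner_edge c = e & @incident G c (inr s).
  rewrite inE => /andP[_ /eqP sv] es.
  have [c cv ce] := corner_exists (side_edges_incident es).
  by exists c; [rewrite cv|rewrite -incident_side_edges ?ce].
exists (side_edges @: S); last first.
  move=> B /imsetP[s]; rewrite inE => /andP[_ /eqP sv] ->.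
  exists (corner_edge (val s).1), (corner_edge (val s).2).
  have [_ N] := sideP s; have [_ _ ne _] := N; split=> //.
  by left; apply/(next_edgeP g_loopless r_small); rewrite -sv.
apply/and3P; split.
(* A corner whose edge of [g] is not in [M] must be matched by a side, and conversely. *)
- apply/eqP/setP => e; rewrite !inE ffunE; apply/bigcupP/andP.
    case=> _ /imsetP[s sS ->] /(blockE s e sS)[c [cv ce] cs].
    split; first by rewrite -cv -ce corner_incident.
    move: sS; rewrite inE => /andP[sM _]; apply/negP => eM.
    have : @incident G c (inl e) by rewrite incident_inl ce.
    by move=> /(matched_once pM sM eM cs).
  case=> ve eM; have [c cv ce] := corner_exists ve.
  have [[f|s] aM ca] := matched c pM.
    by move: ca aM; rewrite incident_inl ce => /eqP->; rewrite (negPf eM).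
  have sv := side_vertex_incident ca; exists (side_edges s).
    by apply/imset_f; rewrite inE aM sv cv eqxx.
  by rewrite -ce incident_side_edges.
(* An edge shared by two blocks would be a corner matched by two different sides. *)
- apply/finset.trivIsetP => _ _ /imsetP[s sS ->] /imsetP[t tS ->] st.
  rewrite disjoint_subset; apply/fintype.subsetP => e es; apply/negP => et.
  have [c [cv ce] cs] := blockE s e sS es.
  have [c' [c'v c'e] ct] := blockE t e tS et.
  have cc' : c' = c by apply: corner_eq; rewrite ?cv ?ce.
  move: sS tS ct; rewrite !inE cc' => /andP[sM _] /andP[tM _] ct.
  have [E] := matched_once pM sM tM cs ct.
  by move/eqP: st; apply; rewrite E.
- apply/imsetP => -[s _ /setP/(_ (corner_edge (val s).1))].
  by rewrite !inE eqxx.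
Qed.

Lemma lucas_trace A : A \in Luc emb ->
  exists2 M, perfect_matching M & trace M = A.
Proof.
rewrite inE => /asboolP lA; have {lA} /choice[P PP] : forall v,
    exists P : {set {set edge g}}, finset.partition P (n_edges A v) /\
    forall B, B \in P -> exists2 s, side_vertex s = v & side_edges s = B.
  move=> v; have [P pP PB] := lA v; exists P; split=> // B /PB[e [f [-> ef]]].
  case=> /(next_edgeP g_loopless r_small)/side_of_next[s [sv se sf]];
    by exists s => //; rewrite /side_edges se sf// finset.setUC.
(* One side is selected per block: on a 2-gon both sides realize the same block, and taking both
   would match its corners twice. *)
pose ch v B := [pick s | (side_vertex s == v) && (side_edges s == B)].
pose M : {set edge G} := [set a | match a with
  | inl e => A e
  | inr s => (side_edges s \in P (side_vertex s)) &&
             (ch (side_vertex s) (side_edges s) == Some s) end].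
exists M; last by apply/ffunP => e; rewrite ffunE inE.
apply: perfect_matchingI => c; set v := corner_vertex c; set e := corner_edge c.
have [/and3P[/eqP cov /finset.trivIsetP triv _] PB] := PP v.
have [Ae|Ae] := boolP (A e).
  exists (inl e); first by rewrite inE Ae incident_inl eqxx.
  move=> [f|s] bM cb; first by move: cb; rewrite incident_inl => /eqP->.
  have sv := side_vertex_incident cb.
  move: cb; rewrite -incident_side_edges// => es.
  move: bM; rewrite inE sv => /andP[sP _].
  have : e \in finset.cover (P v) by apply/bigcupP; exists (side_edges s).
  by rewrite cov !inE Ae andbF.
have : e \in finset.cover (P v) by rewrite cov !inE Ae corner_incident.
case/bigcupP => B BP eB; have [s0 s0v s0B] := PB B BP.
have [s chs] : exists s, ch v B = Some s.
  rewrite /ch; case: pickP => [s _|/(_ s0)]; first by exists s.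
  by rewrite s0v s0B !eqxx.
have [sv sB] : side_vertex s = v /\ side_edges s = B.
  by move: chs; rewrite /ch; case: pickP => // t /andP[/eqP tv /eqP tB] [<-].
exists (inr s); first by rewrite inE sv sB BP chs eqxx -incident_side_edges ?sB.
move=> [f|t] bM cb.
  move: cb bM; rewrite incident_inl => /eqP->; rewrite inE.
  by rewrite (negPf Ae).
have tv := side_vertex_incident cb.
move: cb; rewrite -incident_side_edges// => et.
move: bM; rewrite inE tv => /andP[tP /eqP cht].
(* The two blocks share [e], so they coincide, and the selection then identifies the sides. *)
have tB : side_edges t = B.
  apply/eqP; apply: contraT => /(triv _ _ tP BP).
  by rewrite disjoint_subset => /fintype.subsetP/(_ e et); rewrite inE eB.
by move: cht; rewrite tB chs => -[->].
Qed.

(** * Matchings with a given trace *)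

Lemma matched_sides M c s t : perfect_matching M ->
  (val s).1 = c -> (val t).2 = c ->
  (inr s \in M) = (inl (corner_edge c) \notin M) && (inr t \notin M).
Proof.
(* The edges of [G] at [c] are the one coming from [g], the side leaving [c] and the side entering
   it; [M] contains exactly one of these three. *)
move=> pM sc tc; have cs : @incident G c (inr s) by rewrite incident_inr sc eqxx.
have ct : @incident G c (inr t) by rewrite incident_inr tc eqxx orbT.
have ce : @incident G c (inl (corner_edge c)) by rewrite incident_inl.
apply/idP/andP => [sM|[eM tM]].
  split; apply/negP => aM; first by have := matched_once pM sM aM cs ce.
  have [E] := matched_once pM sM aM cs ct.
  by apply: (@side_neq s); rewrite sc -tc E.
have [[f|u] aM ca] := matched c pM.
  by move: ca aM; rewrite incident_inl => /eqP->; rewrite (negPf eM).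
case/orP: ca => /eqP E; first by rewrite (@side_src_inj s u)// sc.
by move: tM; rewrite (@side_tgt_inj t u) ?aM// tc.
Qed.

(** The corners at a special vertex can only be matched by sides, so its polygon has sides;
    membership of such a side will reveal whether the polygon was flipped. *)
Lemma special_side M v : perfect_matching M -> special (trace M) v ->
  0 < deg v -> exists s, side_vertex s = v.
Proof.
move=> pM spv /card_gt0P[e]; rewrite inE => ve.
have [c cv ce] := corner_exists ve.
have [[f|s] aM ca] := matched c pM; last first.
  by exists s; rewrite (side_vertex_incident ca).
move: ca aM; rewrite incident_inl ce => /eqP->.
by have /forallP/(_ e) := spv; rewrite ve ffunE => /negPf->.
Qed.

Definition flip M (X : {set vertex g}) : {set edge G} :=
  [set a | match a with
           | inl _ => a \in M
           | inr s => (a \in M) (+) (side_vertex s \in X) end].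

Lemma trace_flip M X : trace (flip M X) = trace M.
Proof. by apply/ffunP => e; rewrite !ffunE inE. Qed.

(** At a special vertex every corner is matched by exactly one of its two polygon sides, and
    complementing exchanges the two; elsewhere nothing changes. *)
Lemma flip_perfect M (X : {set vertex g}) : perfect_matching M ->
  X \subset [set v | special (trace M) v] -> perfect_matching (flip M X).
Proof.
move=> pM /fintype.subsetP Xsp; apply: perfect_matchingI => c.
have [cX|cX] := boolP (corner_vertex c \in X); last first.
  have [a aM ca] := matched c pM; exists a.
    rewrite ca andbT inE; case: a aM ca => // s aM ca.
    by rewrite aM (side_vertex_incident ca) (negPf cX).
  move=> b; rewrite inE => bM cb; apply: (matched_once pM) (cb) (ca) => //.
  case: b bM cb => // s + cb.
  by rewrite (side_vertex_incident cb) (negPf cX) addbF.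
have eM : inl (corner_edge c) \notin M.
  have := Xsp _ cX; rewrite inE => /forallP/(_ (corner_edge c)).
  by rewrite corner_incident ffunE.
have dc : 1 < deg (corner_vertex c).
  have [[f|s] aM ca] := matched c pM.
    by move: ca aM; rewrite incident_inl => /eqP->; rewrite (negPf eM).
  by rewrite -(side_vertex_incident ca) side_deg.
have [s sc] := side_src_exists dc; have [t tc] := side_tgt_exists dc.
have st := matched_sides pM sc tc; rewrite eM /= in st.
have sv : side_vertex s \in X by rewrite /side_vertex sc.
have tv : side_vertex t \in X by rewrite /side_vertex (sideP t).1 tc.
(* The new partner of [c] is whichever of its two sides is absent from [M]. *)
exists (inr (if inr t \in M then s else t)).
  rewrite inE; case: ifP => tM; rewrite ?sv ?tv ?st tM /= incident_inr.
    by rewrite sc eqxx.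
  by rewrite tc eqxx orbT.
move=> [f|u] bM cb.
  by move: cb bM; rewrite incident_inl => /eqP->; rewrite inE (negPf eM).
move: bM; rewrite inE (side_vertex_incident cb) cX addbT.
case/orP: cb => /eqP E uM; [have us : u = s by apply: side_src_inj; rewrite sc
  |have us : u = t by apply: side_tgt_inj; rewrite tc].
  by move: uM; rewrite us st negbK => ->.
by move: uM; rewrite us => /negPf->.
Qed.

(* Going around the polygon at v, whether two matchings with the same trace agree
   on a side determines whether they agree on the next one. *)
Lemma flip_surj M M' : perfect_matching M -> perfect_matching M' ->
  trace M' = trace M ->
  exists2 X : {set vertex g}, X \subset [set v | special (trace M) v] &
    M' = flip M X.
Proof.
move=> pM pM' tr; pose diff s := (inr s \in M) != (inr s \in M').
have trE e : (inl e \in M') = (inl e \in M).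
  by have /ffunP/(_ e) := tr; rewrite !ffunE.
(* If the edge of [g] at [c] were in [M], hence in [M'], both matchings would omit [s]. *)
have corner_sp s c : diff s -> (val s).1 = c -> inl (corner_edge c) \notin M.
  move=> ds sc; have [|t tc] := @side_tgt_exists c.
    by rewrite -sc; exact: side_deg.
  apply: contra ds => eM; rewrite (matched_sides pM sc tc) (matched_sides pM' sc tc).
  by rewrite trE eM.
(* The edge of [g] at the common corner is in neither matching, so in each of them membership of [t]
   is the negation of that of [s]. *)
have diff_next s t : (val s).2 = (val t).1 -> diff s -> diff t.
  move=> st ds; rewrite /diff (matched_sides pM (erefl _) st).
  rewrite (matched_sides pM' (erefl _) st) trE.
  have eM : inl (corner_edge (val t).1) \notin M.
    apply: contra ds => eM; rewrite -st in eM.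
    have cs : @incident G (val s).2 (inr s) by rewrite incident_inr eqxx orbT.
    have ce : @incident G (val s).2 (inl (corner_edge (val s).2)).
      by rewrite incident_inl.
    have sM : inr s \notin M.
      by apply/negP => sM; have := matched_once pM sM eM cs ce.
    rewrite -trE in eM.
    have sM' : inr s \notin M'.
      by apply/negP => sM'; have := matched_once pM' sM' eM cs ce.
    by rewrite (negPf sM) (negPf sM').
  by rewrite eM /=; move: ds; rewrite /diff; do 2!case: (_ \in _).
have diff_all := side_closed diff_next.
pose X := [set v | [exists s, diff s && (side_vertex s == v)]].
have XE s : (side_vertex s \in X) = diff s.
  rewrite inE; apply/existsP/idP => [[t /andP[dt /eqP ts]]|ds].
    exact: diff_all ts dt.
  by exists s; rewrite ds /=.
exists X.
  apply/fintype.subsetP => v; rewrite !inE => /existsP[s /andP[ds /eqP sv]].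
  apply/forallP => e; apply/implyP => ve; rewrite ffunE.
  have [c cv ce] := corner_exists ve; rewrite -ce.
  (* Disagreement spreads around the polygon to the side starting at the corner of [e], which keeps
     [e] out of [M]. *)
  have [|t tc] := @side_src_exists c; first by rewrite cv -sv side_deg.
  apply: (corner_sp t) => //; apply: diff_all ds.
  by rewrite sv -cv -tc.
apply/setP => -[e|s]; rewrite inE ?trE// XE /diff.
by do 2!case: (_ \in _).
Qed.

(** [flip M] is a bijection from the sets of special vertices onto the fibre of [trace]. Positive
    degrees exclude isolated vertices, which would be vacuously special but carry no polygon. *)
Lemma card_matchings_trace M : (forall v, 0 < deg v) -> perfect_matching M ->
  #|[set M' : {set edge G} | perfect_matching M' && (trace M' == trace M)]| =
  2 ^ Sp (trace M).
Proof.
move=> deg_gt0 pM; rewrite /Sp -card_powerset.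
rewrite -(@card_in_imset _ _ (flip M)); last first.
  move=> X Y; rewrite !inE => XS YS /setP E; apply/setP => v.
  have [spv|spv] := boolP (special (trace M) v).
    have [s <-] := special_side pM spv (deg_gt0 v).
    by have := E (inr s); rewrite !inE; do 3!case: (_ \in _).
  have notin (Z : {set vertex g}) : Z \subset [set v | special (trace M) v] ->
      v \notin Z.
    by move=> /fintype.subsetP ZS; apply: contra spv => /ZS; rewrite inE.
  by rewrite (negPf (notin X XS)) (negPf (notin Y YS)).
congr #|pred_of_set _|; apply/setP => M'; rewrite inE; apply/andP/imsetP.
  move=> [pM' /eqP tr]; have [X XS ->] := flip_surj pM pM' tr.
  by exists X => //; rewrite inE.
by move=> [X]; rewrite inE => XS ->; rewrite flip_perfect// trace_flip eqxx.
Qed.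

End Counting.

(** * Summation over the Lucas-colorings *)

Lemma connected_deg_gt0 (g : multigraph) : graph_connected g ->
  2 <= #|vertex g| -> forall v : vertex g, 0 < deg v.
Proof.
move=> conn V2 v; have [w wv] : exists w : vertex g, w != v.
  move: V2; rewrite -cardsT (cardsD1 v) inE ltnS => /card_gt0P[w].
  by rewrite !inE andbT; exists w.
have /connectP[[|u p] /=] := conn v w; first by move=> _ E; rewrite E eqxx in wv.
case/andP => /existsP[e /andP[ve _]] _ _.
by apply/card_gt0P; exists e; rewrite inE.
Qed.

Theorem theorem5 (R : realType) (g : multigraph)
    (g_loopless : loopless g) (g_connected : graph_connected g)
    (g_vertices : (2 <= #|vertex g|)%N)
    (emb : smooth_embedding R g)
    (r : vertex g -> R) (r_small : small_disks emb r) :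
  num_perfect_matchings (polygon_graph emb r) =
  (\sum_(A in Luc emb) 2 ^ Sp A)%N.
Proof.
have deg_gt0 := connected_deg_gt0 g_connected g_vertices.
rewrite /num_perfect_matchings -sum1_card.
(* Matchings are grouped by their trace; surjectivity onto [Luc emb] then provides the base matching
   from which each fibre is counted. *)
rewrite (partition_big (@trace R g emb r) (mem (Luc emb))) /=; last first.
  by move=> M; rewrite inE; exact: trace_lucas.
apply: eq_bigr => A /(lucas_trace g_loopless r_small)[M pM <-].
rewrite -(card_matchings_trace r_small deg_gt0 pM) -sum1_card.
by apply: eq_bigl => M'; rewrite !inE.
Qed.
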